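(* Let $n,m\geq 1$ and let $u=(u^1,\dots,u^m):\mathbb{R}^n\to\mathbb{R}^m$ be a smooth map satisfying on all of $\mathbb{R}^n$ the self-shrinking system in Euclidean space $$\sum_{i,j=1}^n g^{ij}u^{\alpha}_{ij}=-u^{\alpha}+x\cdot Du^{\alpha},\qquad \alpha=1,\dots,m,$$ where $(g^{ij})$ is the inverse of $g_{ij}=\delta_{ij}+\sum_{\alpha=1}^m u^\alpha_i u^\alpha_j$. Suppose that the graph of $u$ is rotationally symmetric with respect to the origin, i.e. each $u^\alpha(x)$ depends only on $r=|x|=\sqrt{x_1^2+\cdots+x_n^2}$. Then the graph of $u$ is the plane $\mathbb{R}^n=\mathbb{R}^n\times\{0\}\subset\mathbb{R}^{n+m}$, i.e. $u\equiv 0$.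
   Context: Notation: $u^\alpha_i=\partial u^\alpha/\partial x_i$, $u^\alpha_{ij}=\partial^2u^\alpha/\partial x_i\partial x_j$, $Du^\alpha=(u^\alpha_1,\dots,u^\alpha_n)$, $\cdot$ is the standard inner product on $\mathbb{R}^n$. *)

(* Defs.v *)
(* MathComp-Analysis *)
From HB Require Import structures.
From mathcomp Require Import all_boot all_order all_algebra.
From mathcomp Require Import all_classical all_reals all_analysis.

Set Implicit Arguments.
Unset Strict Implicit.
Unset Printing Implicit Defensive.

Import Order.TTheory GRing.Theory Num.Theory.
Import numFieldNormedType.Exports.

Local Open Scope classical_set_scope.
Local Open Scope ring_scope.

Section Definitions.
Variable R : realType.

Definition component n m (u : 'rV[R]_n -> 'rV[R]_m) (a : 'I_m) : 'rV[R]_n -> R :=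
  fun x => u x 0 a.

Definition partial n (i : 'I_n) (f : 'rV[R]_n -> R) : 'rV[R]_n -> R :=
  fun x => 'D_(delta_mx 0 i) f x.

Fixpoint Ck n (k : nat) (f : 'rV[R]_n -> R) : Prop :=
  continuous f /\
  if k is k'.+1 then
    forall i : 'I_n,
      (forall x, derivable f x (delta_mx 0 i)) /\ Ck k' (partial i f)
  else True.

Definition smooth n m (u : 'rV[R]_n -> 'rV[R]_m) : Prop :=
  forall (a : 'I_m) (k : nat), Ck k (component u a).

(* The library norm `|x| on 'rV[R]_n is the sup norm, hence this one. *)
Definition enorm n (x : 'rV[R]_n) : R := Num.sqrt (\sum_(i < n) x 0 i ^+ 2).

Definition dot n (x y : 'rV[R]_n) : R := \sum_(i < n) x 0 i * y 0 i.

Definition grad n (f : 'rV[R]_n -> R) (x : 'rV[R]_n) : 'rV[R]_n :=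
  \row_(i < n) partial i f x.

(* The metric induced on the graph of u by R^(n+m); it is positive definite,
   so that invmx below is a genuine inverse. *)
Definition metric n m (u : 'rV[R]_n -> 'rV[R]_m) (x : 'rV[R]_n) : 'M[R]_n :=
  \matrix_(i < n, j < n)
    ((i == j)%:R +
     \sum_(a < m) partial i (component u a) x * partial j (component u a) x).

Definition self_shrinking n m (u : 'rV[R]_n -> 'rV[R]_m) : Prop :=
  forall (x : 'rV[R]_n) (a : 'I_m),
    \sum_(i < n) \sum_(j < n)
       invmx (metric u x) i j * partial j (partial i (component u a)) x
    = - component u a x + dot x (grad (component u a) x).

Definition rotationally_symmetric n m (u : 'rV[R]_n -> 'rV[R]_m) : Prop :=
  forall a : 'I_m, exists phi : R -> R, forall x, component u a x = phi (enorm x).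

Definition graph_of n m (u : 'rV[R]_n -> 'rV[R]_m) : set 'rV[R]_(n + m) :=
  [set row_mx x (u x) | x in [set: 'rV[R]_n]].

Definition horizontal_plane n m : set 'rV[R]_(n + m) :=
  [set row_mx x 0 | x in [set: 'rV[R]_n]].

End Definitions.

Arguments horizontal_plane R n m : clear implicits.

(* Main.v *)
(* Write u(x) = f(|x|), p = f', y = |p|^2 and H = p' / (1 + y). Along the first
   axis the system becomes H = - f + t p - (n - 1) p / t for t > 0, with
   p(0) = 0, and differentiating it gives, for q = <p, H>,
     y' = 2 (1 + y) q,   q' >= (t - (n - 1) / t) (1 + y) q,   q(0) = 0.
   The second relation propagates the signs of q forward: q >= 0 everywhere, and
   q > 0 after any time at which q > 0. In that case q' >= y' / 2 for large t,
   hence q >= c (1 + y) for some c > 0, and 1 / (1 + y), whose derivative is at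
   most - 2 c, would become negative in finite time. So q = 0, whence y = 0,
   p = 0, and finally f = 0 by the equation. *)
Require Import Defs.
From HB Require Import structures.
From mathcomp Require Import all_boot all_order all_algebra.
From mathcomp Require Import all_classical all_reals all_analysis.
From mathcomp Require Import ring lra.

Set Implicit Arguments.
Unset Strict Implicit.
Unset Printing Implicit Defensive.

Import Order.TTheory GRing.Theory Num.Theory.
Import numFieldNormedType.Exports.

Local Open Scope classical_set_scope.
Local Open Scope ring_scope.

(** * One-variable calculus and a minimum principle *)

Lemma is_derive1_continuous (R : realType) (f : R -> R) (x d : R) :
  is_derive x 1 f d -> {for x, continuous f}.
Proof.
by case=> fx _; apply: differentiable_continuous; apply/derivable1_diffP.
Qed.

Lemma is_derive_ge0_le (R : realType) (f df : R -> R) (a b : R) :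
  a <= b -> continuous f ->
  (forall x, a < x < b -> is_derive x 1 f (df x)) ->
  (forall x, a < x < b -> 0 <= df x) ->
  f a <= f b.
Proof.
rewrite le_eqVlt => /predU1P[-> //|ab] cf dfx df0.
have dfx' x : x \in `]a, b[ -> is_derive x 1 f (df x).
  by rewrite in_itv /=; apply: dfx.
have [c] := MVT ab dfx' (continuous_subspaceT cf).
rewrite in_itv /= => /df0 c0 E.
by rewrite -subr_ge0 E mulr_ge0 // subr_ge0 ltW.
Qed.

(** The Carathéodory slope of [f] at [c] is continuous there with value [d > 0], so it stays
    positive at points slightly to the left of [c]. *)
Lemma is_derive_gt0_left_lt (R : realType) (f : R -> R) (a c d : R) :
  a < c -> is_derive c 1 f d -> 0 < d -> exists2 x, a < x < c & f x < f c.
Proof.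
move=> ac /is_derive1_caratheodory[g [fE cg gc]] d0.
have near_gt0 : \forall x \near c, 0 < g x.
  by apply: (cvgr_gt _ cg); rewrite gc.
have [e /= e0 he] := near_gt0.
pose x := Num.max ((a + c) / 2) (c - e / 2).
have xc : x < c by rewrite /x gt_max; apply/andP; split; lra.
have ax : a < x by rewrite /x lt_max; apply/orP; left; lra.
exists x; first by rewrite ax xc.
have gx : 0 < g x.
  apply: he => /=; rewrite gtr0_norm ?subr_gt0 //.
  have : c - e / 2 <= x by rewrite /x le_max lexx orbT.
  lra.
by rewrite -subr_lt0 fE pmulr_rlt0 // subr_lt0.
Qed.

(* A negative value of [g] would make [g t * expR (- K t)] attain a negative
   minimum at a point where it is strictly increasing. *)
Lemma ge0_of_supersolution (R : realType) (g dg : R -> R) (K b : R) :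
  0 <= b -> continuous g -> 0 <= g 0 ->
  (forall t : R, 0 < t <= b -> is_derive t 1 g (dg t)) ->
  (forall t : R, 0 < t <= b -> g t < 0 -> K * g t < dg t) ->
  0 <= g b.
Proof.
move=> b0 cg g0 Dg dgK; rewrite leNgt; apply/negP => gb.
pose h t := g t * expR (- K * t).
have De (t : R) : is_derive t 1 (fun t => expR (- K * t)) (- K * expR (- K * t)).
  apply: is_derive_eq; rewrite /GRing.scale /=; ring.
have ch : continuous h.
  move=> t; apply: cvgM; first exact: cg.
  exact: is_derive1_continuous (De t).
have [|c] := @EVT_min R h 0 b b0; first exact: continuous_subspaceT.
rewrite in_itv /= => /andP[c0 cb] hmin.
have hc : h c < 0.
  apply: le_lt_trans (hmin b _) _; first by rewrite in_itv /= b0 lexx.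
  by rewrite /h pmulr_llt0 // expR_gt0.
have gc : g c < 0 by move: hc; rewrite /h pmulr_llt0 // expR_gt0.
have {}c0 : 0 < c.
  rewrite lt_neqAle c0 andbT; apply: contraTneq gc => <-.
  by rewrite -leNgt.
have Dh : is_derive c 1 h ((dg c - K * g c) * expR (- K * c)).
  have Dgc := Dg c; rewrite c0 cb in Dgc; have {}Dgc := Dgc isT.
  apply: (is_derive_eq (is_deriveM Dgc (De c))).
  rewrite /GRing.scale /=; ring.
have [|x /andP[x0 xc]] := is_derive_gt0_left_lt c0 Dh.
  by rewrite mulr_gt0 ?expR_gt0 // subr_gt0 dgK // c0.
rewrite ltNge hmin // in_itv /=; lra.
Qed.

(** * The scalar differential inequality and its blow-up argument *)

(** Here [N] stands for [n - 1]. Since [N / t] is singular at 0, [q] is differentiated only at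
    positive times; its initial value enters through continuity. *)
Lemma supersolution_eq0 (R : realType) (N : R) (y q dq : R -> R) :
  0 <= N -> continuous q -> (forall t, 0 <= y t) -> y 0 = 0 -> q 0 = 0 ->
  (forall t : R, is_derive t 1 y (2 * (1 + y t) * q t)) ->
  (forall t : R, 0 < t -> is_derive t 1 q (dq t)) ->
  (forall t : R, 0 < t -> (t - N / t) * (1 + y t) * q t <= dq t) ->
  forall t, 0 <= t -> y t = 0.
Proof.
move=> N0 cq y0 y00 q00 Dy Dq dqq.
have cy : continuous y by move=> t; apply: is_derive1_continuous (Dy t).
have q_ge0 b : 0 <= b -> 0 <= q b.
  move=> b0.
  have [|c _ cmax] := @EVT_max R y 0 b b0; first exact: continuous_subspaceT.
  (* The constant must exceed [(t - N / t) * (1 + y t)] on []0, b]]: the term in [N] only lowers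
     this, [y c] is the maximum of [y], and the final 1 makes the bound strict. *)
  apply: (@ge0_of_supersolution R q dq (b * (1 + y c) + 1) b) => //.
  - by rewrite q00.
  - by move=> t /andP[t0 _]; apply: Dq.
  move=> t /andP[t0 tb] qt.
  apply: lt_le_trans (dqq t t0).
  rewrite -subr_gt0 -mulrBl nmulr_lgt0 // subr_lt0.
  have yt : y t <= y c by apply: cmax; rewrite in_itv /= ltW.
  have Nt : 0 <= N / t by rewrite divr_ge0 // ltW.
  have {}Nt : 0 <= N / t * (1 + y t) by rewrite mulr_ge0 // addr_ge0.
  have : t * (1 + y t) <= b * (1 + y c).
    by apply: ler_pM => //; rewrite ?lerD2l ?addr_ge0 // ltW.
  by lra.
have y_ndecr a b : 0 <= a -> a <= b -> y a <= y b.
  move=> a0 ab.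
  apply: (is_derive_ge0_le ab cy (fun x _ => Dy x)) => x /andP[ax _].
  rewrite !mulr_ge0 ?addr_ge0 // q_ge0 //; lra.
have q_gt0 a b : 0 < a -> a <= b -> 0 < q a -> 0 < q b.
  move=> a0 ab qa.
  (* On [[a, b]] this dominates [N / t * (1 + y t)], the only negative part of the coefficient of
     [q], so [q t * expR (K * t)] cannot decrease. *)
  pose K := N / a * (1 + y b).
  pose h (t : R) := q t * expR (K * t).
  have De (t : R) : is_derive t 1 (fun t => expR (K * t)) (K * expR (K * t)).
    apply: is_derive_eq; rewrite /GRing.scale /=; ring.
  have : h a <= h b.
    apply: (@is_derive_ge0_le _ h (fun t => (dq t + K * q t) * expR (K * t))) => //.
    - move=> t; apply: cvgM; first exact: cq.
      exact: is_derive1_continuous (De t).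
    - move=> t /andP[at_ _].
      apply: (is_derive_eq (is_deriveM (Dq t (lt_trans a0 at_)) (De t))).
      rewrite /GRing.scale /=; ring.
    move=> t /andP[at_ tb]; have t0 := lt_trans a0 at_.
    rewrite mulr_ge0 ?expR_ge0 //.
    have qt : 0 <= q t by rewrite q_ge0 // ltW.
    have : N / t * (1 + y t) * q t <= K * q t.
      rewrite ler_wpM2r // /K ler_pM ?addr_ge0 ?divr_ge0 // ?(ltW t0) //.
        by rewrite ler_wpM2l // lef_pV2 // ltW.
      by rewrite lerD2l y_ndecr // ltW.
    have := dqq t t0; have : 0 <= t * (1 + y t) * q t.
      by rewrite !mulr_ge0 ?addr_ge0 // ltW.
    rewrite mulrBl mulrBl; lra.
  move/(lt_le_trans _)=> H; have : 0 < h b by apply: H; rewrite mulr_gt0 ?expR_gt0.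
  by rewrite pmulr_lgt0 // expR_gt0.
suff q_le0 t : 0 < t -> q t <= 0.
  move=> t t0; apply/eqP; rewrite eq_le y0 andbT -y00 -lerN2.
  apply: (@is_derive_ge0_le _ (- y) (fun t => - (2 * (1 + y t) * q t))) => //.
  - by move=> x; apply: cvgN; apply: cy.
  move=> x /andP[x0 _]; rewrite oppr_ge0 mulr_ge0_le0 ?q_le0 // mulr_ge0 //.
  by rewrite addr_ge0.
move=> t0; rewrite leNgt; apply/negP => qt.
pose a := Num.max t (N + 1).
have Na : N + 1 <= a by rewrite /a le_max lexx orbT.
have qa : 0 < q a by apply: q_gt0 qt; rewrite // /a le_max lexx.
have y1 x : 0 < 1 + y x by have := y0 x; lra.
(* From [a] on, the coefficient [t - N / t] is at least 1, so [q' >= y' / 2]. *)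
have q_ge b : a <= b -> q a - y a / 2 <= q b - y b / 2.
  move=> ab.
  apply: (@is_derive_ge0_le _ (fun t => q t - y t / 2)
    (fun t => dq t - (1 + y t) * q t)) => //.
  - by move=> x; apply: cvgB; [exact: cq|apply: cvgMl; exact: cy].
  - move=> x /andP[ax xb]; have x0 : 0 < x by lra.
    have Dyx := Dy x; have Dqx := Dq x x0.
    by apply: is_derive_eq; rewrite /GRing.scale /=; field.
  move=> x /andP[ax xb]; have x0 : 0 < x by lra.
  rewrite subr_ge0; apply: le_trans (dqq x x0).
  rewrite -mulrA ler_peMl ?mulr_ge0 ?addr_ge0 ?q_ge0 //; first by lra.
  rewrite -subr_ge0.
  have -> : x - N / x - 1 = (x * (x - 1) - N) / x by field; lra.
  rewrite divr_ge0 //; last lra.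
  have : (1 + N) * N <= x * (x - 1) by apply: ler_pM; lra.
  have : 0 <= N * N by rewrite mulr_ge0.
  lra.
(* The second bound gives [q >= c * (1 + y)] at [a]; the first lets [q_ge] carry it forward, as [q]
   grows by at least half the growth of [y]. *)
pose c := Num.min (1 / 2) (q a / (1 + y a)).
have c0 : 0 < c by rewrite /c lt_min !divr_gt0.
have c2 : c <= 1 / 2 by rewrite /c ge_min lexx.
have cqa : c * (1 + y a) <= q a.
  by rewrite -ler_pdivlMr // /c ge_min lexx orbT.
have q_gec b : a <= b -> c * (1 + y b) <= q b.
  move=> ab; have := q_ge b ab.
  have : c * (y b - y a) <= 1 / 2 * (y b - y a).
    by rewrite ler_wpM2r // subr_ge0 y_ndecr //; lra.
  lra.
(* Over a length [c^-1], a decay rate of at least [2 * c] costs [(1 + y)^-1] at least 2, although it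
   is at most 1 at [a] and positive at [b]. *)
pose b := a + c^-1.
have ab : a <= b by rewrite /b lerDl invr_ge0 ltW.
have : - (1 + y a)^-1 - 2 * c * a <= - (1 + y b)^-1 - 2 * c * b.
  have DV (x : R) : is_derive x 1 (fun t => - (1 + y t)^-1 - 2 * c * t)
      (2 * q x / (1 + y x) - 2 * c).
    have Dyx := Dy x; have y1x : 1 + y x != 0 by rewrite gt_eqF.
    have D1 : is_derive x 1 (fun t => 1 + y t) (2 * (1 + y x) * q x).
      by apply: is_derive_eq; rewrite add0r mul1r.
    have DV1 := @is_deriveV R (fun t => 1 + y t) x _ 1 y1x D1.
    apply: is_derive_eq; rewrite /GRing.scale /=; field.
    exact: y1x.
  apply: (is_derive_ge0_le (f := fun t => - (1 + y t)^-1 - 2 * c * t) ab _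
    (fun x _ => DV x)).
    by move=> x; apply: is_derive1_continuous (DV x).
  move=> x /andP[/ltW ax _]; rewrite subr_ge0 -mulrA ler_wpM2l //.
  by rewrite ler_pdivlMr // q_gec.
have -> : 2 * c * b = 2 * c * a + 2 by rewrite /b; field; lra.
have : (1 + y a)^-1 <= 1 by rewrite invf_le1 //; have := y0 a; lra.
have : 0 < (1 + y b)^-1 by rewrite invr_gt0.
lra.
Qed.

(** * The ordinary differential system of the radial profile *)

Lemma is_derive1_sum (R : realType) (m : nat) (h : 'I_m -> R -> R)
  (dh : 'I_m -> R) (t : R) :
  (forall a, is_derive t 1 (h a) (dh a)) ->
  is_derive t 1 (fun s => \sum_(a < m) h a s) (\sum_(a < m) dh a).
Proof.
move=> Dh; have -> : (fun s => \sum_(a < m) h a s) = \sum_(a < m) h a.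
  by apply/funext => s; rewrite fct_sumE.
exact: is_derive_sum.
Qed.

Lemma profile_eq0 (R : realType) (m : nat) (N : R) (f p p' : 'I_m -> R -> R) :
  0 <= N ->
  (forall a (t : R), is_derive t 1 (f a) (p a t)) ->
  (forall a (t : R), is_derive t 1 (p a) (p' a t)) ->
  (forall a, continuous (p' a)) ->
  (forall a, p a 0 = 0) ->
  (forall a (t : R), 0 < t ->
    p' a t / (1 + \sum_(b < m) p b t ^+ 2) + N / t * p a t
    = - f a t + t * p a t) ->
  forall a (t : R), 0 <= t -> f a t = 0.
Proof.
move=> N0 Df Dp cp' p0 ode.
pose y t := \sum_(b < m) p b t ^+ 2.
pose H a t := p' a t / (1 + y t).
pose q t := \sum_(b < m) p b t * H b t.
pose H' a t := (t - N / t) * p' a t + N / t ^+ 2 * p a t.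
pose dq t := \sum_(b < m) (p' b t * H b t + p b t * H' b t).
have y_ge0 t : 0 <= y t by apply: sumr_ge0 => b _; rewrite sqr_ge0.
have y1 t : 1 + y t != 0 by rewrite gt_eqF // ltr_pwDl.
have p'E a t : p' a t = (1 + y t) * H a t by rewrite /H mulrC divfK.
have Dy (t : R) : is_derive t 1 y (2 * (1 + y t) * q t).
  have D b : is_derive t 1 (fun s => p b s ^+ 2) (2 * p b t * p' b t).
    by have Dpb := Dp b t; apply: is_derive_eq; rewrite /GRing.scale /=; ring.
  apply: (is_derive_eq (is_derive1_sum D)); rewrite mulr_sumr.
  by apply: eq_bigr => b _; rewrite p'E; ring.
have cy : continuous y by move=> t; apply: is_derive1_continuous (Dy t).
have cq : continuous q.
  move=> t; apply: cvg_big => [|b _]; first exact: add_continuous.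
  apply: cvgM.
    exact: is_derive1_continuous (Dp b t).
  apply: cvgM; first exact: cp'.
  apply: cvgV => //; apply: cvgD; [exact: cvg_cst|exact: cy].
(* Only continuity of [p'] is assumed. The equation expresses [H] through [f] and [p] alone, so [H]
   is differentiable without any third derivative of [f]; in [H'] the terms [- p] and [p] cancel. *)
have HE a (t : R) : 0 < t -> H a t = - f a t + t * p a t - N * t^-1 * p a t.
  by move=> t0; rewrite /H; have := ode a t t0; rewrite -/(y t); lra.
have DH a (t : R) : 0 < t -> is_derive t 1 (H a) (H' a t).
  move=> t0; have tn0 : t != 0 by rewrite gt_eqF.
  apply: (@near_eq_is_derive _ _ _
    (fun t => - f a t + t * p a t - N * t^-1 * p a t)).
    near=> s; rewrite HE //; near: s; exact: lt_nbhsr.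
  have Dfa := Df a t; have Dpa := Dp a t.
  have DV : is_derive t 1 (fun s : R => s^-1) (- t ^- 2).
    by apply: (is_derive_eq (is_deriveV tn0 (is_derive_id t 1))); exact: mulr1.
  apply: is_derive_eq; rewrite /GRing.scale /= /H'.
  by field.
have Dq (t : R) : 0 < t -> is_derive t 1 q (dq t).
  move=> t0; apply: is_derive1_sum => b.
  have Dpb := Dp b t; have DHb := DH b t t0.
  apply: is_derive_eq; rewrite /GRing.scale /=; ring.
have yE0 : forall t : R, 0 <= t -> y t = 0.
  apply: (supersolution_eq0 N0 cq y_ge0 _ _ Dy Dq).
  - by apply: big1 => b _; rewrite p0 expr0n.
  - by apply: big1 => b _; rewrite p0 mul0r.
  move=> t t0; rewrite mulr_sumr ler_sum // => b _.
  rewrite -subr_ge0 /H' !p'E.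
  set z := (X in 0 <= X).
  (* The part [(t - N / t) * p'] of [H'] cancels against the lower bound, and what is left is a sum
     of squares with nonnegative weights. *)
  have -> : z = (1 + y t) * H b t ^+ 2 + N * (p b t / t) ^+ 2.
    by rewrite /z; field; rewrite gt_eqF.
  by rewrite addr_ge0 // mulr_ge0 ?sqr_ge0 ?addr_ge0.
have p_eq0 a (t : R) : 0 <= t -> p a t = 0.
  move=> /yE0/eqP; rewrite psumr_eq0 => [|b _]; last exact: sqr_ge0.
  by move=> /allP/(_ a (mem_index_enum _))/=; rewrite sqrf_eq0 => /eqP.
have f_eq0 a (t : R) : 0 < t -> f a t = 0.
  move=> t0; have p'0 : p' a t = 0.
    have [_ <-] := Dp a t.
    have [_ <-] : is_derive t 1 (p a) 0; last by [].
    apply: (@near_eq_is_derive _ _ _ (cst (0 : R))).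
    near=> s; rewrite p_eq0 //; near: s.
    have := lt_nbhsr t0; apply: filterS => s /ltW //.
  have := ode a t t0; rewrite p'0 (p_eq0 a t (ltW t0)) mul0r !mulr0 addr0 addr0.
  by move/eqP; rewrite eq_sym oppr_eq0 => /eqP.
(* The equation says nothing at time 0. There [f a 0 = f a 1] is used, obtained from two
   monotonicity bounds since [p] vanishes in between. *)
move=> a t; rewrite le_eqVlt => /predU1P[<-|]; last exact: f_eq0.
have cf : continuous (f a) by move=> s; apply: is_derive1_continuous (Df a s).
have f0_le : f a 0 <= f a 1.
  apply: (is_derive_ge0_le ler01 cf (fun s _ => Df a s)) => s /andP[/ltW s0 _].
  by rewrite p_eq0.
have f0_ge : - f a 0 <= - f a 1.
  apply: (@is_derive_ge0_le _ (fun s => - f a s) (fun s => - p a s)) => //.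
    by move=> s; apply: cvgN; apply: cf.
  by move=> s /andP[/ltW s0 _]; rewrite p_eq0 // oppr0.
have := f_eq0 a 1 ltr01; lra.
Unshelve. all: by end_near.
Qed.

(** * Reduction of the system to the first coordinate axis *)

Lemma invmx_diag (F : fieldType) (n : nat) (d : 'rV[F]_n) :
  (forall i, d 0 i != 0) -> invmx (diag_mx d) = diag_mx (\row_i (d 0 i)^-1).
Proof.
move=> d0; have dV : diag_mx (\row_i (d 0 i)^-1) *m diag_mx d = 1%:M.
  rewrite mulmx_diag -diag_const_mx; congr diag_mx; apply/rowP => i.
  by rewrite !mxE mulVf.
have [_ du] := mulmx1_unit dV.
by rewrite -[LHS]mul1mx -dV mulmxK.
Qed.

(** The two difference quotients coincide. This turns partial derivatives into derivatives along a
    line, where the one-variable chain rule applies. *)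
Lemma is_derive_line (R : realType) (n : nat) (F : 'rV[R]_n -> R)
  (x v : 'rV[R]_n) (s : R) :
  derivable F (x + s *: v) v ->
  is_derive s 1 (fun s => F (x + s *: v)) ('D_v F (x + s *: v)).
Proof.
have E : (fun h : R => h^-1 *:
      (((fun s : R => F (x + s *: v)) \o shift s) (h *: 1) - F (x + s *: v)))
    = (fun h => h^-1 *: ((F \o shift (x + s *: v)) (h *: v) - F (x + s *: v))).
  apply/funext => h /=; congr (_ *: (F _ - _)).
  by rewrite [h%:A]mulr1 scalerDl addrCA.
by move=> D; split; rewrite /derivable /derive E.
Qed.

Section Profile.
Variables (R : realType) (k m : nat) (u : 'rV[R]_k.+1 -> 'rV[R]_m).
Hypotheses (u_smooth : smooth u) (u_sym : rotationally_symmetric u).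

Local Notation e i := (delta_mx 0 i : 'rV[R]_k.+1).
Local Notation u_ a := (component u a).

(** The function [phi] supplied by the symmetry carries no regularity. Restricting [u] to the whole
    axis, negative [t] included, gives a profile that is differentiable across 0. *)
Let f a (t : R) := u_ a (t *: e 0).
Let p a (t : R) := partial 0 (u_ a) (t *: e 0).
Let p' a (t : R) := partial 0 (partial 0 (u_ a)) (t *: e 0).

Lemma derivable_component a i x : derivable (u_ a) x (e i).
Proof. by have [_ /(_ i)[+ _]] := u_smooth a 1; apply. Qed.

Lemma derivable_partial a i j x : derivable (partial i (u_ a)) x (e j).
Proof. by have [_ /(_ i)[_ [_ /(_ j)[+ _]]]] := u_smooth a 2; apply. Qed.

Lemma continuous_partial2 a i j : continuous (partial j (partial i (u_ a))).
Proof. by have [_ /(_ i)[_ [_ /(_ j)[_ []]]]] := u_smooth a 2. Qed.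

Lemma is_derive_profile a (t : R) : is_derive t 1 (f a) (p a t).
Proof.
have := @is_derive_line _ _ (u_ a) 0 (e 0) t; rewrite add0r.
under eq_fun do rewrite add0r.
by apply; exact: derivable_component.
Qed.

Lemma is_derive_dprofile a (t : R) : is_derive t 1 (p a) (p' a t).
Proof.
have := @is_derive_line _ _ (partial 0 (u_ a)) 0 (e 0) t; rewrite add0r.
under eq_fun do rewrite add0r.
by apply; exact: derivable_partial.
Qed.

Lemma continuous_ddprofile a : continuous (p' a).
Proof.
move=> t; apply: (@continuous_comp _ _ _ (fun s : R => s *: e 0)).
  exact: scalel_continuous.
exact: continuous_partial2.
Qed.

Lemma enorm_axis (t : R) : enorm (t *: e 0) = `|t|.
Proof.
rewrite /enorm (bigD1 0) //= big1 ?addr0 => [|i /negPf i0].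
  by rewrite !mxE !eqxx mulr1 sqrtr_sqr.
by rewrite !mxE i0 mulr0 expr0n.
Qed.

Lemma enorm_plane (t s : R) (j : 'I_k.+1) :
  j != 0 -> enorm (t *: e 0 + s *: e j) = Num.sqrt (t ^+ 2 + s ^+ 2).
Proof.
move=> j0; rewrite /enorm (bigD1 0) //= (bigD1 j) //= big1 ?addr0.
  rewrite !mxE !eqxx [0 == j]eq_sym (negPf j0) !mulr1 !mulr0.
  by rewrite addr0 add0r.
by move=> i /andP[/negPf i0 /negPf ij]; rewrite !mxE i0 ij !mulr0 addr0 expr0n.
Qed.

Lemma profileE a x : u_ a x = f a (enorm x).
Proof.
have [phi phiE] := u_sym a.
by rewrite /f !phiE enorm_axis ger0_norm // sqrtr_ge0.
Qed.

(** The profile is even, so its derivative at 0 equals its own opposite. *)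
Lemma dprofile0 a : p a 0 = 0.
Proof.
have fN : f a = f a \o -%R.
  by apply/funext => t; rewrite /= /f !profileE !enorm_axis normrN.
have D0 := is_derive_profile a 0.
have D1 : is_derive (- 0 : R) 1 (f a) (p a 0) by rewrite oppr0.
have D2 := is_derive1_comp D1 (is_deriveNid (0 : R) 1).
have [_ E0] := D0; have [_ E2] := D2; rewrite -fN E0 in E2.
move: E2; lra.
Qed.

(** Chain rule for [f] composed with the radius in the plane of [e 0] and [e j]; [0 < t] keeps the
    square root away from its singularity. Values off the axis are needed for the second derivative
    in the direction [e j]. *)
Lemma partial_plane a (t s : R) (j : 'I_k.+1) : 0 < t -> j != 0 ->
  partial j (u_ a) (t *: e 0 + s *: e j) =
  p a (Num.sqrt (t ^+ 2 + s ^+ 2)) / Num.sqrt (t ^+ 2 + s ^+ 2) * s.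
Proof.
move=> t0 j0; set r := Num.sqrt _.
have r2 : 0 < t ^+ 2 + s ^+ 2 by rewrite ltr_pwDl ?sqr_ge0 // exprn_gt0.
have r0 : 0 < r by rewrite sqrtr_gt0.
have := is_derive_line (@derivable_component a j (t *: e 0 + s *: e j)).
rewrite /partial => -[_ <-].
under eq_fun do rewrite profileE enorm_plane //.
have Dr : is_derive s 1 (fun s => Num.sqrt (t ^+ 2 + s ^+ 2)) (s / r).
  have Dq : is_derive s 1 (fun s => t ^+ 2 + s ^+ 2) (2 * s).
    by apply: is_derive_eq; rewrite /GRing.scale /=; ring.
  have D := is_derive1_comp (g := fun s => t ^+ 2 + s ^+ 2)
    (is_derive1_sqrt r2) Dq.
  apply: (is_derive_eq D).
  by rewrite -/r; field; rewrite gt_eqF.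
have [_ ->] := is_derive1_comp (g := fun s => Num.sqrt (t ^+ 2 + s ^+ 2))
  (is_derive_profile a r) Dr.
by rewrite mulrAC mulrA.
Qed.

Lemma partial_axis a (t : R) (j : 'I_k.+1) : 0 < t -> j != 0 ->
  partial j (u_ a) (t *: e 0) = 0.
Proof.
move=> t0 j0; have := @partial_plane a t 0 j t0 j0.
by rewrite scale0r addr0 mulr0.
Qed.

(** Along [e j] the first derivative has the form [g s * s] with [g] continuous at 0. Carathéodory's
    criterion then gives the derivative [g 0], without differentiating [g]. *)
Lemma partial2_axis a (t : R) (j : 'I_k.+1) : 0 < t -> j != 0 ->
  partial j (partial j (u_ a)) (t *: e 0) = p a t / t.
Proof.
move=> t0 j0.
have := is_derive_line (@derivable_partial a j j (t *: e 0 + 0 *: e j)).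
under eq_fun do rewrite partial_plane //.
rewrite scale0r addr0 -/(partial _ _ _) => -[_ <-].
pose g (s : R) := p a (Num.sqrt (t ^+ 2 + s ^+ 2)) / Num.sqrt (t ^+ 2 + s ^+ 2).
have g0 : Num.sqrt (t ^+ 2 + 0 ^+ 2) = t.
  by rewrite expr0n addr0 sqrtr_sqr gtr0_norm.
suff [_ ->] : is_derive (0 : R) 1 (fun s => g s * s) (p a t / t) by [].
apply/is_derive1_caratheodory; exists g; split.
- by move=> z; rewrite mulr0 !subr0.
- have cr : {for 0, continuous (fun s : R => Num.sqrt (t ^+ 2 + s ^+ 2))}.
    apply: (@continuous_comp _ _ _ (fun s : R => t ^+ 2 + s ^+ 2)).
      apply: cvgD; first exact: cvg_cst.
      exact: exprn_continuous.
    exact: sqrt_continuous.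
  apply: cvgM; last by apply: cvgV => //; rewrite g0 gt_eqF.
  apply: continuous_comp cr _.
  exact: is_derive1_continuous (is_derive_dprofile _ _).
- by rewrite /g g0.
Qed.

(** On the positive half-axis all gradients point along [e 0], so the metric is diagonal with
    entries [Y, 1, ..., 1] and mixed second derivatives drop out. Each of the [k] transversal
    directions contributes [p a t / t]. *)
Lemma profile_ode : self_shrinking u -> forall a (t : R), 0 < t ->
  p' a t / (1 + \sum_(b < m) p b t ^+ 2) + k%:R / t * p a t
  = - f a t + t * p a t.
Proof.
move=> u_shrink a t t0.
have := u_shrink (t *: e 0) a.
set Y := 1 + _; pose d : 'rV[R]_k.+1 := \row_i (if i == 0 then Y else 1).
have Y0 : Y != 0.
  by rewrite gt_eqF // ltr_pwDl // sumr_ge0 // => b _; rewrite sqr_ge0.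
have -> : metric u (t *: e 0) = diag_mx d.
  apply/matrixP => i j; rewrite !mxE; have [->|i0] := eqVneq i 0.
    have [->|j0] := eqVneq j 0; rewrite ?eqxx ?mulr1n.
      by rewrite /Y; congr (_ + _); apply: eq_bigr => b _; rewrite expr2.
    rewrite mulr0n big1 ?addr0 // => b _.
    by rewrite (partial_axis b t0 j0) mulr0.
  rewrite big1 ?addr0 // => b _.
  by rewrite (partial_axis b t0 i0) mul0r.
rewrite invmx_diag; last first.
  by move=> i; rewrite mxE; case: ifP => // _; exact: oner_neq0.
rewrite (eq_bigr (fun i =>
  (d 0 i)^-1 * partial i (partial i (u_ a)) (t *: e 0))); last first.
  move=> i _; rewrite (bigD1 i) //= big1 ?addr0 => [|j /negPf ji].
    by rewrite !mxE eqxx mulr1n.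
  by rewrite !mxE [i == j]eq_sym ji mulr0n mul0r.
rewrite (bigD1 0) //= (eq_bigr (fun=> p a t / t)); last first.
  by move=> i i0; rewrite partial2_axis // mxE (negPf i0) invr1 mul1r.
rewrite sumr_const cardC1 card_ord /= mxE eqxx.
rewrite /dot (bigD1 0) //= big1 ?addr0 => [|i i0]; last first.
  by rewrite !mxE (negPf i0) mulr0 mul0r.
rewrite !mxE !eqxx mulr1 -/(p a t) -/(p' a t) -/(f a t) => <-.
by rewrite -mulr_natr; congr (_ + _); ring.
Qed.

End Profile.

Theorem proposition13 (R : realType) (n m : nat) (hn : (1 <= n)%N)
  (hm : (1 <= m)%N) (u : 'rV[R]_n -> 'rV[R]_m)
  (u_smooth : smooth u)
  (u_shrink : self_shrinking u)
  (u_sym : rotationally_symmetric u) :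
  graph_of u = horizontal_plane R n m /\ (forall x : 'rV[R]_n, u x = 0).
Proof.
suff u0 x : u x = 0.
  by split=> //; rewrite /graph_of /horizontal_plane; under eq_fun do rewrite u0.
(* Writing the dimension as [k.+1] provides the axis [e 0], and [k] becomes the constant [N] of the
   profile equation. *)
case: n hn u u_smooth u_shrink u_sym x => // k _ u u_smooth u_shrink u_sym x.
apply/rowP => a; rewrite mxE -/(component u a x) profileE //.
apply: (profile_eq0 (ler0n R k) (is_derive_profile u_smooth)
  (is_derive_dprofile u_smooth) (continuous_ddprofile u_smooth)
  (dprofile0 u_smooth u_sym) (profile_ode u_smooth u_sym u_shrink)).
exact: sqrtr_ge0.
Qed.
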